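(* Let $N$ be a proper slant submanifold of a Kaehlerian manifold $(M,g,J)$. If $\nabla F=0$, then $N$ is austere.
   Context: For $X$ tangent to $N$ write $JX=PX+FX$ with $PX$ tangent and $FX$ normal to $N$. With $\nabla$ the Levi-Civita connection of $N$ and $D$ the normal connection, $(\nabla_XF)Y=D_X(FY)-F(\nabla_XY)$. $N$ is slant if the angle between $JX$ and $T_xN$ is a constant $\theta$ independent of $x\in N$ and nonzero $X\in T_xN$; it is proper slant if moreover $\theta\neq0,\pi/2$. $N$ is austere if for each normal vector $\xi$ the set of eigenvalues (with multiplicity) of the Weingarten map $A_\xi$, $\langle A_\xi X,Y\rangle=\langle h(X,Y),\xi\rangle$, is invariant under multiplication by $-1$; equivalently all invariants of odd order of $A_\xi$ vanish. *)

(* Defs.v *)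
(* Tangent vectors are written in coordinates as row vectors, linear maps act
   on the right (v *m A) and a bilinear form with matrix G sends (u, v) to
   u *m G *m v^T.  In accordance with this, 'J f x is the matrix such that
   'd f x v = v *m 'J f x.

   Tensors and vector fields are given classically, by their components in the
   charts.  Charts carry total functions in both directions; only their values
   on the domain and on its image are constrained or used, and these sets are
   open, so derivatives at their points are meaningful. *)

From HB Require Import structures.
From mathcomp Require Import all_boot all_order all_algebra.
From mathcomp Require Import all_classical all_reals all_analysis.

Set Implicit Arguments.
Unset Strict Implicit.
Unset Printing Implicit Defensive.

Import Order.TTheory GRing.Theory Num.Theory numFieldNormedType.Exports.

Local Open Scope classical_set_scope.
Local Open Scope ring_scope.

(* C^oo on an open set U: every iterated directional derivative is Frechet
   differentiable at every point of U. *)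
Definition smooth_on (R : realType) (V W : normedModType R)
    (U : set V) (f : V -> W) : Prop :=
  forall (vs : seq V) (x : V), U x ->
    differentiable (foldr (fun (v : V) (g : V -> W) => 'D_v g) f vs) x.

Record chart (R : realType) (M : topologicalType) (n : nat) := Chart {
  cdom : set M;
  cmap :> M -> 'rV[R]_n;
  cinv : 'rV[R]_n -> M;
  cdom_open : open cdom;
  cimg_open : open (cmap @` cdom);
  cmapK : forall p, cdom p -> cinv (cmap p) = p;
  cmap_continuous : {within cdom, continuous cmap};
  cinv_continuous : {within cmap @` cdom, continuous cinv} }.

Definition cimg (R : realType) (M : topologicalType) (n : nat)
  (c : chart R M n) : set 'rV[R]_n := c @` cdom c.

Definition transition (R : realType) (M : topologicalType) (n : nat)
  (c d : chart R M n) : 'rV[R]_n -> 'rV[R]_n := d \o cinv c.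

Record manifold (R : realType) (n : nat) := Manifold {
  points :> topologicalType;
  atlas : set (chart R points n);
  manifold_hausdorff : hausdorff_space points;
  manifold_second_countable : @second_countable points;
  atlas_cover : forall p : points, exists2 c, atlas c & cdom c p;
  atlas_smooth : forall c d, atlas c -> atlas d ->
    smooth_on (c @` (cdom c `&` cdom d)) (transition c d) }.

Section LeviCivita.
Variables (R : realType) (k : nat).
Implicit Types (G : 'rV[R]_k -> 'M[R]_k) (x u v : 'rV[R]_k).

Definition inner G x u v : R := (u *m G x *m v^T) 0 0.

Definition gnorm G x u : R := Num.sqrt (inner G x u u).

(* The vector Gamma(u, v) at x, i.e. the covariant derivative in direction u of
   the field with constant components v; raises the index of
   Gamma_{uv,l} = (d_u g_{vl} + d_v g_{ul} - d_l g_{uv}) / 2. *)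
Definition christoffel G x u v : 'rV[R]_k :=
  (\row_l (2^-1 * ('D_u (fun y => inner G y v (delta_mx 0 l)) x
                 + 'D_v (fun y => inner G y u (delta_mx 0 l)) x
                 - 'D_(delta_mx 0 l) (fun y => inner G y u v) x)))
  *m invmx (G x).

Definition cov G (V : 'rV[R]_k -> 'rV[R]_k) x (X : 'rV[R]_k) : 'rV[R]_k :=
  'D_X V x + christoffel G x X (V x).

End LeviCivita.

Record kaehler_manifold (R : realType) (k : nat) := KaehlerManifold {
  kmanifold :> manifold R k;
  metric : chart R kmanifold k -> 'rV[R]_k -> 'M[R]_k;
  cplx : chart R kmanifold k -> 'rV[R]_k -> 'M[R]_k;
  metric_smooth : forall c, atlas c -> smooth_on (cimg c) (metric c);
  metric_sym : forall c x, atlas c -> cimg c x ->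
    (metric c x)^T = metric c x;
  metric_pos : forall c x u, atlas c -> cimg c x -> u != 0 ->
    0 < inner (metric c) x u u;
  metric_tensor : forall c d x, atlas c -> atlas d ->
    (c @` (cdom c `&` cdom d)) x ->
    metric c x = 'J (transition c d) x *m metric d (transition c d x)
                   *m ('J (transition c d) x)^T;
  cplx_smooth : forall c, atlas c -> smooth_on (cimg c) (cplx c);
  cplx_tensor : forall c d x, atlas c -> atlas d ->
    (c @` (cdom c `&` cdom d)) x ->
    cplx c x *m 'J (transition c d) x
      = 'J (transition c d) x *m cplx d (transition c d x);
  cplx_sqr : forall c x, atlas c -> cimg c x ->
    cplx c x *m cplx c x = - 1%:M;
  cplx_isometry : forall c x u v, atlas c -> cimg c x ->
    inner (metric c) x (u *m cplx c x) (v *m cplx c x)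
      = inner (metric c) x u v;
  (* J is parallel: nabla_X (J V) = J (nabla_X V) *)
  cplx_parallel : forall c (V : 'rV[R]_k -> 'rV[R]_k) x X, atlas c ->
    smooth_on (cimg c) V -> cimg c x ->
    cov (metric c) (fun y => V y *m cplx c y) x X
      = cov (metric c) V x X *m cplx c x }.

(* [phi] is the coordinate expression of an immersion, [G] and [J] are the
   components of the ambient metric and complex structure.  Vectors tangent to
   N are in 'rV_n, ambient vectors in 'rV_k, and the differential of phi sends
   X to X *m 'J phi x. *)

Section LocalGeometry.
Variables (R : realType) (n k : nat).
Variables (G J : 'rV[R]_k -> 'M[R]_k) (phi : 'rV[R]_n -> 'rV[R]_k).
Implicit Types (x X : 'rV[R]_n) (v : 'rV[R]_k).

Definition pullback_metric x : 'M[R]_n :=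
  'J phi x *m G (phi x) *m ('J phi x)^T.

(* Components in T_xN of the G-orthogonal projection of v: the solution X of
   <X, Y>_N = <v, dphi Y> for all Y. *)
Definition tangent_part x v : 'rV[R]_n :=
  v *m G (phi x) *m ('J phi x)^T *m invmx (pullback_metric x).

Definition normal_part x v : 'rV[R]_k := v - tangent_part x v *m 'J phi x.

Definition is_normal x v : Prop :=
  forall X, inner G (phi x) v (X *m 'J phi x) = 0.

Definition J_op x X : 'rV[R]_k := X *m 'J phi x *m J (phi x).
Definition P_op x X : 'rV[R]_n := tangent_part x (J_op x X).
Definition F_op x X : 'rV[R]_k := normal_part x (J_op x X).

(* Angle between JX and T_xN, that is, between JX and its projection PX. *)
Definition slant_angle x X : R :=
  acos (gnorm G (phi x) (P_op x X *m 'J phi x) / gnorm G (phi x) (J_op x X)).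

(* V is a vector field along phi; the derivative is that of the ambient space. *)
Definition cov_along (V : 'rV[R]_n -> 'rV[R]_k) x X : 'rV[R]_k :=
  'D_X V x + christoffel G (phi x) (X *m 'J phi x) (V x).

Definition normal_cov (V : 'rV[R]_n -> 'rV[R]_k) x X : 'rV[R]_k :=
  normal_part x (cov_along V x X).

(* (nabla_X F) Y = D_X (F Y) - F (nabla_X Y), for a vector field Y on N. *)
Definition nablaF (Y : 'rV[R]_n -> 'rV[R]_n) x X : 'rV[R]_k :=
  normal_cov (fun y => F_op y (Y y)) x X - F_op x (cov pullback_metric Y x X).

(* Gauss formula; h is tensorial, and the vector Y is extended by the field
   with constant components. *)
Definition second_fundamental_form x X Y : 'rV[R]_k :=
  cov_along (fun y => Y *m 'J phi y) x X
  - cov pullback_metric (fun=> Y) x X *m 'J phi x.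

(* The matrix A with <X *m A, Y>_N = <h(X, Y), xi>. *)
Definition weingarten x (xi : 'rV[R]_k) : 'M[R]_n :=
  (\matrix_(i, j) inner G (phi x)
      (second_fundamental_form x (delta_mx 0 i) (delta_mx 0 j)) xi)
  *m invmx (pullback_metric x).

End LocalGeometry.

Section Submanifold.
Variables (R : realType) (n k : nat).

Section Immersion.
Variables (N : manifold R n) (M : manifold R k) (f : N -> M).

Definition local_rep (a : chart R N n) (b : chart R M k) :
  'rV[R]_n -> 'rV[R]_k := b \o f \o cinv a.

Definition local_dom (a : chart R N n) (b : chart R M k) : set 'rV[R]_n :=
  [set x | cimg a x /\ cdom b (f (cinv a x))].

Definition immersion : Prop :=
  continuous f /\
  forall a b, atlas a -> atlas b ->
    smooth_on (local_dom a b) (local_rep a b) /\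
    forall x, local_dom a b x -> row_free ('J (local_rep a b) x).

End Immersion.

Variables (N : manifold R n) (M : kaehler_manifold R k) (f : N -> M).

Definition slant (theta : R) : Prop :=
  forall a b x (X : 'rV[R]_n), atlas a -> atlas b ->
    local_dom f a b x -> X != 0 ->
    slant_angle (metric b) (cplx b) (local_rep f a b) x X = theta.

Definition proper_slant : Prop :=
  exists theta : R, [/\ slant theta, theta <> 0 & theta <> pi / 2].

Definition F_parallel : Prop :=
  forall a b (Y : 'rV[R]_n -> 'rV[R]_n) x X, atlas a -> atlas b ->
    smooth_on (local_dom f a b) Y -> local_dom f a b x ->
    nablaF (metric b) (cplx b) (local_rep f a b) Y x X = 0.

(* The Weingarten maps are self-adjoint, so all their eigenvalues are real;
   multiplicities are those of the roots of the characteristic polynomial. *)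
Definition austere : Prop :=
  forall a b x (xi : 'rV[R]_k), atlas a -> atlas b -> local_dom f a b x ->
    is_normal (metric b) (local_rep f a b) x xi ->
    forall lam : R,
      mup lam (char_poly (weingarten (metric b) (local_rep f a b) x xi))
      = mup (- lam) (char_poly (weingarten (metric b) (local_rep f a b) x xi)).

End Submanifold.

(* Main.v *)
(* For a normal vector xi let S(X, Y) = <h(X, Y), xi>.  As the ambient J is
   parallel, nabla F = 0 says that S(X, PY) = <J h(X, Y), xi>.  Since h is
   symmetric, so is the right-hand side, whence S(X, PY) = S(PX, Y).  As P is
   skew for the induced metric, this means P A_xi = - A_xi P.  The slant angle
   is not pi / 2, so P is injective, and it conjugates A_xi to - A_xi. *)
Require Import Defs.
From HB Require Import structures.
From mathcomp Require Import all_boot all_order all_algebra.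
From mathcomp Require Import all_classical all_reals all_analysis.
From mathcomp Require Import ring.

Set Implicit Arguments.
Unset Strict Implicit.
Unset Printing Implicit Defensive.

Import Order.TTheory GRing.Theory Num.Theory numFieldNormedType.Exports.

Local Open Scope classical_set_scope.
Local Open Scope ring_scope.

(** * Characteristic polynomials and root multiplicities under similarity and negation *)

Lemma char_poly_simmx (F : fieldType) (n : nat) (P A B : 'M[F]_n) :
  P \in unitmx -> P *m A = B *m P -> char_poly A = char_poly B.
Proof.
move=> uP PA; rewrite /char_poly.
have uQ : map_mx polyC P \in unitmx by rewrite map_unitmx.
have cPA : map_mx polyC P *m char_poly_mx A = char_poly_mx B *m map_mx polyC P.
  by rewrite /char_poly_mx mulmxBr mulmxBl -!map_mxM PA scalar_mxC.
have := congr1 determinant cPA; rewrite !det_mulmx mulrC.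
by apply: mulIr; rewrite -unitmxE.
Qed.

(** Substituting [- 'X] for ['X] in the matrix ['X - A] gives [-('X + A)]; the sign is the
    determinant of [-1] times the identity. *)
Lemma char_polyN (F : fieldType) (n : nat) (A : 'M[F]_n) :
  char_poly (- A) = (-1) ^+ n *: (char_poly A \Po (- 'X)).
Proof.
rewrite /char_poly -det_map_mx -mul_polyC polyC_exp polyCN -detZ.
congr (\det _); apply/matrixP => i j; rewrite !mxE /= mulN1r.
by rewrite linearB /= raddfMn /= comp_polyX comp_polyC polyCN mulNrn opprD !opprK.
Qed.

Lemma dvdp_comp_polyN (F : fieldType) (p q : {poly F}) :
  (p \Po (- 'X) %| q \Po (- 'X)) = (p %| q).
Proof.
have compN r : (r : {poly F}) \Po (- 'X) \Po (- 'X) = r.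
  by rewrite -comp_polyA linearN /= comp_polyX opprK comp_polyXr.
apply/idP/idP => [|]; last exact: dvdp_comp_poly.
by move/(dvdp_comp_poly (- 'X)); rewrite !compN.
Qed.

Lemma mup_comp_polyN (F : fieldType) (p : {poly F}) (a : F) :
  p != 0 -> mup a (p \Po (- 'X)) = mup (- a) p.
Proof.
move=> p0.
have pN0 : p \Po (- 'X) != 0 by rewrite comp_poly2_eq0 // size_polyN size_polyX.
(* Multiplicities are compared through all their lower bounds: substituting [- 'X] in [('X + a)^m]
   gives [('X - a)^m] up to sign, and the substitution preserves divisibility both ways because it
   is an involution. *)
have geqE m : (m <= mup a (p \Po (- 'X)))%N = (m <= mup (- a) p)%N.
  rewrite !mup_geq // -[RHS]dvdp_comp_polyN rmorphXn /= comp_polyB comp_polyX.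
  rewrite comp_polyC polyCN -opprD exprNn.
  by rewrite -signr_odd mulr_sign; case: odd; rewrite ?dvdpNl.
by apply/eqP; rewrite eqn_leq -geqE leqnn geqE leqnn.
Qed.

(** [P] conjugates [A] to [- A], so the characteristic polynomial is invariant under ['X -> - 'X] up
    to a nonzero constant, which does not affect multiplicities. *)
Lemma mup_char_poly_anticomm (F : fieldType) (n : nat) (P A : 'M[F]_n) (a : F) :
  P \in unitmx -> P *m A = - (A *m P) ->
  mup a (char_poly A) = mup (- a) (char_poly A).
Proof.
move=> uP; rewrite -mulNmx => /(char_poly_simmx uP) cA.
have cA0 : char_poly A != 0 by rewrite monic_neq0 ?char_poly_monic.
rewrite {1}cA char_polyN -mup_comp_polyN // -mul_polyC mupMr //.
by rewrite rootC signr_eq0.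
Qed.

(** * Symmetry of second derivatives *)

Section Schwarz.
Variables (R : realType) (V : normedModType R).
Implicit Types (f : V -> R) (x u v w : V).

Lemma is_derive_line f u w (t : R) : differentiable f (t *: u + w) ->
  is_derive t 1 (fun s : R => f (s *: u + w)) ('D_u f (t *: u + w)).
Proof.
move=> df; have fu := @diff_derivable _ _ _ _ _ u df.
suff E : (fun h : R => h^-1 *: (((fun s : R => f (s *: u + w)) \o shift t) (h *: 1)
    - f (t *: u + w))) =
  (fun h : R => h^-1 *: ((f \o shift (t *: u + w)) (h *: u) - f (t *: u + w))).
  by split; rewrite /derivable /derive E.
by apply/funext => h /=; rewrite [_ *: 1]mulr1 scalerDl addrA.
Qed.

(** Second-order difference of [f] over the parallelogram at [x] with sides [h *: u] and [h *: v].
    Its symmetry in [u] and [v] forces the mixed derivatives to agree. *)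
Definition mixed_difference f x u v (h : R) : R :=
  f (h *: u + h *: v + x) - f (h *: u + x) - (f (h *: v + x) - f x).

Lemma mixed_differenceC f x u v h :
  mixed_difference f x u v h = mixed_difference f x v u h.
Proof.
rewrite /mixed_difference (addrC (h *: u)).
by ring.
Qed.

(* Mean value theorem for [t |-> f (x + tu + hv) - f (x + tu)] on [0, h]. *)
Lemma mixed_difference_approx f g x u v (e : R) : 0 < e ->
  (\forall y \near x, differentiable f y /\ 'D_u f y = g y) ->
  differentiable g x ->
  \forall h \near 0^'+,
    `|mixed_difference f x u v h - h ^+ 2 * 'D_v g x| <= e * h ^+ 2.
Proof.
(* [h * k] will bound the sum of the lengths of the two displacements at which [g] is expanded.
   Errors are measured against [e / (k + 1)], since [k] vanishes when [u] and [v] do. *)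
move=> e0 df dg; set k := 2 * `|u| + `|v|.
have k0 : 0 <= k by rewrite addr_ge0 ?mulr_ge0.
have [d /= d0 near_x] : exists2 d : R, 0 < d & forall w, `|w| < d ->
    [/\ differentiable f (w + x), 'D_u f (w + x) = g (w + x) &
    `|g (w + x) - g x - 'd g x w| <= e / (k + 1) * `|w|].
  have /diff_locally/eqaddoP/= oP := dg.
  have ek0 : 0 < e / (k + 1) by rewrite divr_gt0 // ltr_wpDl.
  have := oP _ ek0; move: df; rewrite (near_shift 0 x) => df gx.
  have [d /= d0 dP] := (nbhs_ballP _ _).1 (filterI df gx).
  exists d => // w wd.
  have /dP[/=] : ball (0 : V) d w by rewrite -ball_normE /= sub0r normrN.
  rewrite subr0 => -[fw fgw] gw; split => //; apply: le_trans gw.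
  by rewrite !fctE opprD addrA.
near=> h.
have h0 : 0 < h by [].
(* For such [h] every point used below, [t *: u + x] or [t *: u + h *: v + x] with [t] in [[0, h]],
   is within [d] of [x]. *)
have hd : h * (`|u| + `|v|) < d.
  have : h < d / (`|u| + `|v| + 1).
    by near: h; apply: nbhs_right_lt; rewrite divr_gt0 // ltr_wpDl ?addr_ge0.
  rewrite ltr_pdivlMr ?ltr_wpDl ?addr_ge0 //; apply: le_lt_trans.
  by rewrite ler_pM2l // lerDl.
have norm_u t : 0 <= t <= h -> `|t *: u| <= h * `|u|.
  by move=> /andP[t0 th]; rewrite normrZ ger0_norm // ler_wpM2r.
have norm_uv t : 0 <= t <= h -> `|t *: u + h *: v| <= h * (`|u| + `|v|).
  move=> /norm_u tu; rewrite mulrDr (le_trans (ler_normD _ _)) // lerD //.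
  by rewrite normrZ gtr0_norm.
have norm_u_lt t : 0 <= t <= h -> `|t *: u| < d.
  move=> /norm_u/le_lt_trans; apply; apply: le_lt_trans hd.
  by rewrite ler_pM2l // lerDl.
have norm_uv_lt t : 0 <= t <= h -> `|t *: u + h *: v| < d.
  by move=> /norm_uv/le_lt_trans; apply.
pose F t := f (t *: u + (h *: v + x)) - f (t *: u + x).
have dF t : 0 <= t <= h ->
    is_derive t 1 F (g (t *: u + (h *: v + x)) - g (t *: u + x)).
  move=> th; have [f1 <- _] := near_x _ (norm_u_lt _ th).
  have [] := near_x _ (norm_uv_lt _ th); rewrite -addrA => f2 <- _.
  by apply: is_deriveB; apply: is_derive_line.
have [c /itvP ch] : exists2 c, c \in `]0, h[ &
    F h - F 0 = (g (c *: u + (h *: v + x)) - g (c *: u + x)) * (h - 0).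
  apply: MVT => // [t /itvP th|]; first by apply: dF; rewrite !th.
  apply: derivable_within_continuous => t; rewrite in_itv /= => th.
  by have [] := dF t th.
rewrite subr0 => Fh.
have -> : mixed_difference f x u v h = F h - F 0.
  by rewrite /F /mixed_difference !scale0r !add0r addrA.
rewrite Fh; have c0h : 0 <= c <= h by rewrite !ch.
have [_ _ g1] := near_x _ (norm_uv_lt _ c0h); have [_ _ g2] := near_x _ (norm_u_lt _ c0h).
rewrite deriveE // addrA.
(* The linear parts of the two expansions differ by [h * 'd g x v], whatever the intermediate point
   [c] is; only the two remainders are left to estimate. *)
have -> : (g (c *: u + h *: v + x) - g (c *: u + x)) * h - h ^+ 2 * 'd g x v
  = h * ((g (c *: u + h *: v + x) - g x - 'd g x (c *: u + h *: v))
       - (g (c *: u + x) - g x - 'd g x (c *: u))).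
  have dZ t w : 'd g x (t *: w) = t * 'd g x w by rewrite linearZ.
  by rewrite linearD !dZ; ring.
rewrite normrM gtr0_norm // expr2 mulrCA ler_pM2l //.
apply: le_trans (ler_normB _ _) _; apply: le_trans (lerD g1 g2) _.
rewrite -mulrDr; apply: (@le_trans _ _ (e / (k + 1) * (h * k))).
  apply: ler_wpM2l; first by rewrite ltW // divr_gt0 // ltr_wpDl.
  apply: le_trans (lerD (norm_uv _ c0h) (norm_u _ c0h)) _.
  by rewrite -mulrDr /k ler_pM2l // addrAC -mulr2n mulr_natl.
rewrite mulrCA mulrC ler_pM2r // mulrAC ler_pdivrMr ?ltr_wpDl //.
by rewrite ler_pM2l // lerDl.
Unshelve. all: by end_near. Qed.

(** One and the same mixed difference is [h ^+ 2 * 'D_v g1 x] and [h ^+ 2 * 'D_u g2 x] up to an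
    error small against [h ^+ 2]. Differentiability of the first derivatives at the single point [x]
    replaces continuity of the second ones. *)
Lemma schwarz f g1 g2 x u v :
  (\forall y \near x, differentiable f y) ->
  (\forall y \near x, 'D_u f y = g1 y) -> (\forall y \near x, 'D_v f y = g2 y) ->
  differentiable g1 x -> differentiable g2 x -> 'D_v g1 x = 'D_u g2 x.
Proof.
move=> df dfu dfv dg1 dg2.
have {}dfu : \forall y \near x, differentiable f y /\ 'D_u f y = g1 y by exact: filterI.
have {}dfv : \forall y \near x, differentiable f y /\ 'D_v f y = g2 y by exact: filterI.
apply/eqP; rewrite -subr_eq0 -normr_eq0 eq_le normr_ge0 andbT.
apply/ler_addgt0Pr => e e0; rewrite add0r.
have e20 : 0 < e / 2 by rewrite divr_gt0.
have Nu := mixed_difference_approx v e20 dfu dg1.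
have Nv := mixed_difference_approx u e20 dfv dg2.
have [h [h0 Du Dv]] : exists h, [/\ 0 < h,
    `|mixed_difference f x u v h - h ^+ 2 * 'D_v g1 x| <= e / 2 * h ^+ 2 &
    `|mixed_difference f x v u h - h ^+ 2 * 'D_u g2 x| <= e / 2 * h ^+ 2].
  apply: (@filter_ex _ (0^'+)); near=> h.
  by split; [|exact: (near Nu h)|exact: (near Nv h)].
rewrite mixed_differenceC in Du.
move: ('D_v g1 x) ('D_u g2 x) Du Dv => a b Du Dv.
have h20 : 0 < h ^+ 2 by rewrite exprn_gt0.
rewrite -(ler_pM2r h20) -[in leLHS](gtr0_norm h20) -normrM.
have -> : (a - b) * h ^+ 2 = (mixed_difference f x v u h - h ^+ 2 * b)
  - (mixed_difference f x v u h - h ^+ 2 * a) by ring.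
apply: le_trans (ler_normB _ _) _; apply: le_trans (lerD Dv Du) _.
by rewrite -mulrDl -splitr.
Unshelve. all: by end_near. Qed.

End Schwarz.

(** * Derivatives of matrix-valued functions *)

Section MatrixDerivative.
Variables (R : realType) (V : normedModType R).

Lemma differentiable_entry (m n : nat) (M : V -> 'M[R]_(m, n)) x i j :
  differentiable M x -> differentiable (fun y => M y i j) x.
Proof.
move=> dM; apply: (@differentiable_comp _ _ _ _ M (fun N => N i j)) => //.
exact: differentiable_coord.
Qed.

Lemma is_derive_mxP (m n : nat) (M : V -> 'M[R]_(m, n)) x v D :
  is_derive x v M D <-> forall i j, is_derive x v (fun y => M y i j) (D i j).
Proof.
split=> [[dM <-] i j|dM].
  split; first exact: (derivable_mxP M x v).1.
  by rewrite derive_mx // mxE.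
have dM' : derivable M x v.
  by apply/derivable_mxP => i j; have [] := dM i j.
split=> //; rewrite derive_mx //; apply/matrixP => i j; rewrite mxE.
by have [_] := dM i j.
Qed.

Lemma is_derive_mulmx (m n p : nat) (A : V -> 'M[R]_(m, n))
    (B : V -> 'M[R]_(n, p)) x v dA dB :
  is_derive x v A dA -> is_derive x v B dB ->
  is_derive x v (fun y => A y *m B y) (dA *m B x + A x *m dB).
Proof.
move=> /is_derive_mxP hA /is_derive_mxP hB; apply/is_derive_mxP => i j.
have -> : (fun y => (A y *m B y) i j) =
    \sum_l ((fun y => A y i l) * (fun y => B y l j)).
  by apply/funext => y; rewrite fct_sumE mxE.
apply: is_derive_eq; rewrite !mxE -big_split /=; apply: eq_bigr => l _.
by rewrite addrC [B x l j *: _]mulrC.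
Qed.

Lemma is_derive_mulmxl (m n p : nat) (A : V -> 'M[R]_(m, n))
    (B : 'M[R]_(n, p)) x v dA :
  is_derive x v A dA -> is_derive x v (fun y => A y *m B) (dA *m B).
Proof.
move=> hA; apply: (is_derive_eq (is_derive_mulmx hA (is_derive_cst B x v))).
by rewrite mulmx0 addr0.
Qed.

Lemma is_derive_mulmxr (m n p : nat) (A : 'M[R]_(m, n))
    (B : V -> 'M[R]_(n, p)) x v dB :
  is_derive x v B dB -> is_derive x v (fun y => A *m B y) (A *m dB).
Proof.
move=> hB; apply: (is_derive_eq (is_derive_mulmx (is_derive_cst A x v) hB)).
by rewrite mul0mx add0r.
Qed.

Lemma derivable_mulmx (m n p : nat) (A : V -> 'M[R]_(m, n))
    (B : V -> 'M[R]_(n, p)) x v :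
  derivable A x v -> derivable B x v -> derivable (fun y => A y *m B y) x v.
Proof.
by move=> /derivableP hA /derivableP hB; have [] := is_derive_mulmx hA hB.
Qed.

Lemma derivable_trmx (m n : nat) (A : V -> 'M[R]_(m, n)) x v :
  derivable A x v -> derivable (fun y => (A y)^T) x v.
Proof.
move=> /derivable_mxP dA; apply/derivable_mxP => i j.
under eq_fun do rewrite mxE; exact: dA.
Qed.

Lemma derivable_prod (I : Type) (r : seq I) (f : I -> V -> R) x v :
  (forall i, derivable (f i) x v) ->
  derivable (fun y => \prod_(i <- r) f i y) x v.
Proof.
move=> df; elim: r => [|i r IHr].
  under eq_fun do rewrite big_nil; apply: derivable_cst.
under eq_fun do rewrite big_cons; apply: derivableM; [exact: df|exact: IHr].
Qed.

Lemma derivable_big_sum (I : Type) (r : seq I) (f : I -> V -> R) x v :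
  (forall i, derivable (f i) x v) ->
  derivable (fun y => \sum_(i <- r) f i y) x v.
Proof.
move=> df; elim: r => [|i r IHr].
  under eq_fun do rewrite big_nil; apply: derivable_cst.
under eq_fun do rewrite big_cons; apply: derivableD; [exact: df|exact: IHr].
Qed.

Lemma derivable_det (n : nat) (A : V -> 'M[R]_n) x v :
  derivable A x v -> derivable (fun y => \det (A y)) x v.
Proof.
move=> /derivable_mxP dA; apply: derivable_big_sum => s.
by apply: derivableM; [apply: derivable_cst|apply: derivable_prod].
Qed.

Lemma derivable_invmx (n : nat) (A : V -> 'M[R]_n) x v :
  (\forall y \near x, A y \in unitmx) -> derivable A x v ->
  derivable (fun y => invmx (A y)) x v.
Proof.
move=> uA dA.
(* Cramer's formula describes [invmx] only at invertible matrices; elsewhere [invmx] returns its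
   argument. Hence the comparison is made near [x]. *)
apply: (@near_eq_derivable _ _ _ (fun y => (\det (A y))^-1 *: \adj (A y))).
  by near=> y; rewrite /invmx ifT //; near: y.
have /nbhs_singleton := uA; rewrite unitmxE unitfE => detA.
move/derivable_mxP : (dA) => dAij.
apply/derivable_mxP => i j; under eq_fun do rewrite !mxE.
apply: derivableM; first by apply: derivableV => //; apply: derivable_det.
apply: derivableM; first exact: derivable_cst.
apply: derivable_det; apply/derivable_mxP => k l.
under eq_fun do rewrite !mxE; exact: dAij.
Unshelve. all: by end_near. Qed.

End MatrixDerivative.

Lemma entry_mulmx_delta (R : pzSemiRingType) (m n : nat) (A : 'M[R]_(m, n)) i j :
  ((delta_mx 0 i : 'rV_m) *m A *m (delta_mx 0 j : 'rV_n)^T) 0 0 = A i j.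
Proof. by rewrite trmx_delta -rowE -colE !mxE. Qed.

Lemma scalar_sum_delta (R : comPzRingType) (n : nat) (s : 'rV[R]_n -> R) X :
  scalar s -> s X = \sum_l X 0 l * s (delta_mx 0 l).
Proof.
move=> slin; pose sL : {scalar 'rV[R]_n} :=
  HB.pack s (GRing.isLinear.Build _ _ _ _ _ slin).
rewrite {1}(row_sum_delta X) -[s]/(sL : _ -> _) linear_sum.
by apply: eq_bigr => l _; rewrite linearZ.
Qed.

(** * The metric and its Christoffel symbols *)

Section Inner.
Variables (R : realType) (k : nat) (G : 'rV[R]_k -> 'M[R]_k).
Implicit Types (p u v w : 'rV[R]_k).

Lemma innerDl p u v w : inner G p (u + v) w = inner G p u w + inner G p v w.
Proof. by rewrite /inner !mulmxDl mxE. Qed.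

Lemma innerNl p u w : inner G p (- u) w = - inner G p u w.
Proof. by rewrite /inner !mulNmx mxE. Qed.

Lemma innerBl p u v w : inner G p (u - v) w = inner G p u w - inner G p v w.
Proof. by rewrite innerDl innerNl. Qed.

Lemma innerZl p (a : R) u w : inner G p (a *: u) w = a * inner G p u w.
Proof. by rewrite /inner -!scalemxAl mxE. Qed.

Lemma innerC p u v : (G p)^T = G p -> inner G p u v = inner G p v u.
Proof.
move=> Gsym; have -> : inner G p u v = ((u *m G p *m v^T)^T) 0 0 by rewrite mxE.
by rewrite !trmx_mul trmxK Gsym mulmxA.
Qed.

Lemma is_derive_inner p w u v : derivable G p w ->
  is_derive p w (fun y => inner G y u v) ((u *m 'D_w G p *m v^T) 0 0).
Proof.
move=> /derivableP dG.
exact: (is_derive_mxP _ _ _ _).1 (is_derive_mulmxl v^T (is_derive_mulmxr u dG)) 0 0.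
Qed.

(** The Levi-Civita connection is torsion-free. The last of the three terms is a derivative of the
    metric, so symmetry of [G] is needed on a neighbourhood of [p]; this is why an open [W]
    appears. *)
Lemma christoffelC (W : set 'rV[R]_k) p u v :
  open W -> (forall y, W y -> (G y)^T = G y) -> W p ->
  christoffel G p u v = christoffel G p v u.
Proof.
move=> Wo Gsym Wp; rewrite /christoffel; congr mulmx.
apply/rowP => l; rewrite [LHS]mxE [RHS]mxE.
have -> : 'D_(delta_mx 0 l) (fun y => inner G y u v) p =
          'D_(delta_mx 0 l) (fun y => inner G y v u) p.
  apply: near_eq_derive; apply: filterS (open_nbhs_nbhs (conj Wo Wp)) => y Wy.
  exact/innerC/Gsym.
by rewrite [X in _ * (X - _)]addrC.
Qed.

(** The vector [v] also occurs as a direction of differentiation, and there linearity comes from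
    Frechet differentiability of [G]. *)
Lemma christoffel_linear p u : differentiable G p -> linear (christoffel G p u).
Proof.
move=> dG a v1 v2.
have dGw w : derivable G p w by exact: diff_derivable.
have DE w u' v' : 'D_w (fun y => inner G y u' v') p = (u' *m 'D_w G p *m v'^T) 0 0.
  by have [_] := is_derive_inner u' v' (dGw w).
rewrite /christoffel scalemxAl -mulmxDl; congr (_ *m _).
apply/rowP => l; rewrite !mxE !DE.
have -> : 'D_(a *: v1 + v2) G p = a *: 'D_v1 G p + 'D_v2 G p.
  by rewrite !deriveE // linearP.
have -> : (a *: v1 + v2)^T = a *: v1^T + v2^T by rewrite linearP.
move: ('D_u G p) ('D_v1 G p) ('D_v2 G p) ('D_(delta_mx 0 l) G p) => *.
rewrite !mulmxDr !mulmxDl -!scalemxAr -!scalemxAl !mxE.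
by ring.
Qed.

End Inner.

(** This makes fields with constant components admissible test fields in [F_parallel] and
    [cplx_parallel]. *)
Lemma smooth_on_cst (R : realType) (V W : normedModType R) (U : set V) (c : W) :
  smooth_on U (fun _ : V => c).
Proof.
move=> vs x _.
have [d ->] : exists d, foldr (fun v (g : V -> W) => 'D_v g) (fun=> c) vs = cst d.
  elim: vs => [|v vs [d /= ->]]; first by exists c.
  by exists 0; apply/funext => y; rewrite derive_cst.
exact: differentiable_cst.
Qed.

(** * Covariant derivatives along an immersion, in one pair of charts *)

Section LocalGeometry.
Variables (R : realType) (n k : nat).
Variables (G J : 'rV[R]_k -> 'M[R]_k) (phi : 'rV[R]_n -> 'rV[R]_k).
Variables (U : set 'rV[R]_n) (W : set 'rV[R]_k).
Hypotheses (Uo : open U) (Wo : open W) (phiUW : forall x, U x -> W (phi x)).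
Hypothesis phi_smooth : smooth_on U phi.
Hypothesis phi_imm : forall x, U x -> row_free ('J phi x).
Hypothesis G_smooth : smooth_on W G.
Hypothesis G_sym : forall p, W p -> (G p)^T = G p.
Hypothesis G_pos : forall p u, W p -> u != 0 -> 0 < inner G p u u.
Hypothesis J_smooth : smooth_on W J.
Hypothesis J_sqr : forall p, W p -> J p *m J p = - 1%:M.
Hypothesis J_isometry : forall p u v, W p ->
  inner G p (u *m J p) (v *m J p) = inner G p u v.
(** Parallelism of [J] evaluated on the ambient field with constant components [v]. This pointwise
    form also applies to fields along [phi], which need not extend to the ambient space. *)
Hypothesis J_parallel : forall (p u v : 'rV[R]_k), W p ->
  v *m 'D_u J p + christoffel G p u (v *m J p) = christoffel G p u v *m J p.
Implicit Types (x X Y : 'rV[R]_n).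

Let G_diff p : W p -> differentiable G p.
Proof. exact: (G_smooth [::]). Qed.

Let J_diff p : W p -> differentiable J p.
Proof. exact: (J_smooth [::]). Qed.

Let phi_diff x : U x -> differentiable phi x.
Proof. exact: (phi_smooth [::]). Qed.

Let nearU x (P : set 'rV[R]_n) : U x -> (forall y, U y -> P y) -> \forall y \near x, P y.
Proof. by move=> Ux UP; apply: filterS (open_nbhs_nbhs (conj Uo Ux)). Qed.

Lemma mulmx_jacobian x Y : U x -> Y *m 'J phi x = 'D_Y phi x.
Proof. by move=> Ux; rewrite deriveEjacobian //; apply: phi_diff. Qed.

(** On [U] the rows of the Jacobian are the derivatives of [phi] along basis vectors, which
    [smooth_on] makes differentiable. *)
Lemma derivable_jacobian x X : U x -> derivable (fun y => 'J phi y) x X.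
Proof.
move=> Ux; apply/derivable_mxP => i j.
apply: (@near_eq_derivable _ _ _ (fun y => 'D_(delta_mx 0 i) phi y 0 j)).
  by apply: nearU => // y Uy; rewrite -mulmx_jacobian // -rowE mxE.
have /derivable_mxP : derivable ('D_(delta_mx 0 i) phi) x X; last exact.
by apply: diff_derivable; apply: (phi_smooth [:: _]).
Qed.

(** Both sides are mixed second derivatives of [phi], so [schwarz] applies to each coordinate. *)
Lemma derive_jacobianC x X Y : U x ->
  'D_X (fun y => Y *m 'J phi y) x = 'D_Y (fun y => X *m 'J phi y) x.
Proof.
move=> Ux.
have D2 (X' Y' : 'rV[R]_n) : 'D_X' (fun y => Y' *m 'J phi y) x = 'D_X' ('D_Y' phi) x.
  by apply: near_eq_derive; apply: nearU => // y Uy; rewrite mulmx_jacobian.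
rewrite !D2.
apply/rowP => j.
have dphi Z y : U y -> 'D_Z (fun z => phi z 0 j) y = 'D_Z phi y 0 j.
  move=> /phi_diff/(@diff_derivable _ _ _ _ _ Z)/derivableP.
  by move=> /is_derive_mxP/(_ 0 j)[].
have d2phi Z : differentiable (fun y => 'D_Z phi y 0 j) x.
  exact/differentiable_entry/(phi_smooth [:: Z]).
have d2E Z Z' : 'D_Z' ('D_Z phi) x 0 j = 'D_Z' (fun y => 'D_Z phi y 0 j) x.
  have /(@diff_derivable _ _ _ _ _ Z')/derivableP : differentiable ('D_Z phi) x.
    exact: (phi_smooth [:: Z]).
  by move=> /is_derive_mxP/(_ 0 j)[].
apply: etrans (d2E Y X) _; apply: etrans _ (esym (d2E X Y)).
apply: (@schwarz _ _ (fun y => phi y 0 j) (fun y => 'D_Y phi y 0 j)) => //.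
- by apply: nearU => // y /phi_diff; apply: differentiable_entry.
- by apply: nearU => // y /dphi ->.
- by apply: nearU => // y /dphi ->.
Qed.

(** Ambient covariant derivative of the image under the differential of [phi] of a constant field
    [Y]. It differs from the second fundamental form by a tangent vector, hence agrees with it
    against normal vectors. *)
Local Notation hess x X Y := (cov_along G phi (fun y => Y *m 'J phi y) x X).

Lemma cov_along_jacobianC x X Y : U x -> hess x X Y = hess x Y X.
Proof.
move=> Ux; rewrite /cov_along (derive_jacobianC X Y Ux).
by rewrite (christoffelC _ _ Wo G_sym (phiUW Ux)).
Qed.

Lemma cov_along_jacobian_linear x X : U x -> linear (fun Y => hess x X Y).
Proof.
move=> Ux a Y1 Y2; rewrite /cov_along.
have dJ Y : 'D_X (fun y => Y *m 'J phi y) x = Y *m 'D_X (fun y => 'J phi y) x.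
  by have [] := is_derive_mulmxr Y (derivableP (@derivable_jacobian _ X Ux)).
have /phiUW/G_diff/christoffel_linear linG := Ux.
rewrite (dJ (a *: Y1 + Y2)) (dJ Y1) (dJ Y2) !mulmxDl -!scalemxAl linG.
by rewrite scalerDr addrACA.
Qed.

Lemma cov_alongB x X (V1 V2 : 'rV[R]_n -> 'rV[R]_k) : U x ->
  derivable V1 x X -> derivable V2 x X ->
  cov_along G phi (fun y => V1 y - V2 y) x X =
  cov_along G phi V1 x X - cov_along G phi V2 x X.
Proof.
move=> Ux dV1 dV2; rewrite /cov_along deriveB //.
have /phiUW/G_diff/christoffel_linear lin := Ux.
rewrite -[- V2 x]scaleN1r [V1 x + _]addrC lin scaleN1r.
by rewrite [X in _ + X]addrC opprD addrACA.
Qed.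

(** By the chain rule [J \o phi] varies along [X] as [J] does along the image of [X], so
    [J_parallel] absorbs this term. *)
Lemma cov_along_cplx x X (V : 'rV[R]_n -> 'rV[R]_k) : U x -> derivable V x X ->
  cov_along G phi (fun y => V y *m J (phi y)) x X =
  cov_along G phi V x X *m J (phi x).
Proof.
move=> Ux dV; have Wx := phiUW Ux.
have dJ : is_derive x X (fun y => J (phi y)) ('D_(X *m 'J phi x) J (phi x)).
  have dJphi : differentiable (J \o phi) x.
    exact: differentiable_comp (phi_diff Ux) (J_diff Wx).
  split; first exact: diff_derivable.
  rewrite (deriveE _ dJphi) diff_comp ?deriveE; try exact: J_diff.
    by rewrite /= -(deriveE _ (phi_diff Ux)) mulmx_jacobian.
  exact: phi_diff.
rewrite /cov_along; have [_ ->] := is_derive_mulmx (derivableP dV) dJ.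
by rewrite mulmxDl -J_parallel // addrA.
Qed.

(** Differentiating the components of [T] contributes only a tangent vector; against a normal vector
    just [hess] at the value [T x] survives. *)
Lemma cov_along_tangent x X (T : 'rV[R]_n -> 'rV[R]_n) : U x -> derivable T x X ->
  cov_along G phi (fun y => T y *m 'J phi y) x X =
  'D_X T x *m 'J phi x + hess x X (T x).
Proof.
move=> Ux dT; have dJ := derivableP (@derivable_jacobian _ X Ux).
rewrite /cov_along; have [_ ->] := is_derive_mulmx (derivableP dT) dJ.
by have [_ ->] := is_derive_mulmxr (T x) dJ; rewrite addrA.
Qed.

(** * The induced metric and the tangential part P of J *)

Lemma pullback_metric_sym x : U x -> (pullback_metric G phi x)^T = pullback_metric G phi x.
Proof.
by move=> /phiUW/G_sym Gx; rewrite /pullback_metric !trmx_mul trmxK Gx mulmxA.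
Qed.

(** A vector in the kernel has an image of zero length under the differential of [phi]; this image
    vanishes by positivity, and the vector itself by injectivity. *)
Lemma pullback_metric_unit x : U x -> pullback_metric G phi x \in unitmx.
Proof.
move=> Ux; rewrite -row_free_unit -kermx_eq0; apply/rowV0P => v /sub_kermxP vg.
apply/eqP; rewrite -(mulmx_free_eq0 v (phi_imm Ux)); apply: contraT => v0.
have := G_pos (phiUW Ux) v0; rewrite /inner trmx_mul !mulmxA.
by move: vg; rewrite /pullback_metric !mulmxA => ->; rewrite mul0mx mxE ltxx.
Qed.

Lemma derivable_pullback_metric x X : U x -> derivable (pullback_metric G phi) x X.
Proof.
move=> Ux; apply: derivable_mulmx; last exact/derivable_trmx/derivable_jacobian.
apply: derivable_mulmx; first exact: derivable_jacobian.
apply: diff_derivable; apply: differentiable_comp; first exact: phi_diff.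
exact/G_diff/phiUW.
Qed.

Definition P_mx x : 'M[R]_n :=
  'J phi x *m J (phi x) *m G (phi x) *m ('J phi x)^T *m invmx (pullback_metric G phi x).

Lemma P_opE x X : P_op G J phi x X = X *m P_mx x.
Proof. by rewrite /P_op /tangent_part /J_op /P_mx !mulmxA. Qed.

Lemma derivable_P_mx x X : U x -> derivable P_mx x X.
Proof.
move=> Ux; apply: derivable_mulmx; last first.
  apply: derivable_invmx; last exact: derivable_pullback_metric.
  by apply: nearU => // y; apply: pullback_metric_unit.
apply: derivable_mulmx; last exact/derivable_trmx/derivable_jacobian.
apply: derivable_mulmx; first apply: derivable_mulmx.
- exact: derivable_jacobian.
- by apply: diff_derivable; apply: differentiable_comp; [exact: phi_diff|exact/J_diff/phiUW].
- by apply: diff_derivable; apply: differentiable_comp; [exact: phi_diff|exact/G_diff/phiUW].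
Qed.

(** Multiply the isometry relation [J G J^T = G] on the right by [J^T], whose square is [-1]. *)
Lemma cplx_metric_skew p : W p -> J p *m G p = - (G p *m (J p)^T).
Proof.
move=> Wp; have JGJ : J p *m G p *m (J p)^T = G p.
  apply/matrixP => i j; rewrite -[LHS]entry_mulmx_delta -[RHS]entry_mulmx_delta.
  by have := J_isometry (delta_mx 0 i) (delta_mx 0 j) Wp; rewrite /inner trmx_mul !mulmxA.
have JT2 : (J p)^T *m (J p)^T = - 1%:M by rewrite -trmx_mul J_sqr // linearN /= trmx1.
by rewrite -[in RHS]JGJ -!mulmxA JT2 !mulmxN mulmx1 opprK.
Qed.

(** Multiplying [P_mx] by the induced metric cancels the inverse and leaves the pullback of [J G],
    which is skew-symmetric. *)
Lemma P_mx_skew x : U x ->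
  P_mx x *m pullback_metric G phi x = - (pullback_metric G phi x *m (P_mx x)^T).
Proof.
move=> Ux; set g := pullback_metric G phi x.
have Pg : P_mx x *m g = 'J phi x *m J (phi x) *m G (phi x) *m ('J phi x)^T.
  by rewrite /P_mx mulmxKV ?pullback_metric_unit.
have -> : g *m (P_mx x)^T = (P_mx x *m g)^T by rewrite [RHS]trmx_mul [g^T]pullback_metric_sym.
have Wx := phiUW Ux; rewrite Pg -(mulmxA _ (J _)).
have : (J (phi x) *m G (phi x))^T = - (J (phi x) *m G (phi x)).
  by rewrite trmx_mul G_sym // cplx_metric_skew // opprK.
move: (J _ *m _) => B BT.
by rewrite !trmx_mul trmxK BT mulNmx mulmxN opprK mulmxA.
Qed.

Lemma inner_tangent_normal x X xi : U x -> is_normal G phi x xi ->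
  inner G (phi x) (X *m 'J phi x) xi = 0.
Proof. by move=> Ux xin; rewrite innerC ?G_sym //; apply: phiUW. Qed.

Lemma inner_normal_part x v xi : U x -> is_normal G phi x xi ->
  inner G (phi x) (normal_part G phi x v) xi = inner G (phi x) v xi.
Proof. by move=> Ux xin; rewrite innerBl inner_tangent_normal // subr0. Qed.

(** * The second fundamental form and the Weingarten map *)

Local Notation sff := (second_fundamental_form G phi).

Lemma inner_sff x X Y xi : U x -> is_normal G phi x xi ->
  inner G (phi x) (sff x X Y) xi = inner G (phi x) (hess x X Y) xi.
Proof. by move=> Ux xin; rewrite innerBl inner_tangent_normal // subr0. Qed.

Lemma sffC x X Y : U x -> sff x X Y = sff x Y X.
Proof.
move=> Ux; rewrite /second_fundamental_form (cov_along_jacobianC X Y Ux).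
rewrite /cov (derive_cst Y) (derive_cst X).
by rewrite (christoffelC _ _ Uo pullback_metric_sym Ux).
Qed.

(** Write [F Y] as [J Y - P Y] in the ambient space and differentiate with [Y] constant: the first
    term gives [J] applied to [hess x X Y], the second a tangent vector plus [hess x X (P Y)]. *)
Lemma inner_sff_P x X Y xi : U x -> is_normal G phi x xi ->
  nablaF G J phi (fun=> Y) x X = 0 ->
  inner G (phi x) (hess x X (Y *m P_mx x)) xi =
  inner G (phi x) (sff x X Y *m J (phi x)) xi.
Proof.
move=> Ux xin nF0.
have dJ := @derivable_jacobian _ X Ux.
have dJY : derivable (fun y => Y *m 'J phi y) x X.
  by have [] := is_derive_mulmxr Y (derivableP dJ).
have dYP : derivable (fun y => Y *m P_mx y) x X.
  by have [] := is_derive_mulmxr Y (derivableP (@derivable_P_mx _ X Ux)).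
have dJYJ : derivable (fun y => Y *m 'J phi y *m J (phi y)) x X.
  apply: derivable_mulmx => //; apply: diff_derivable.
  by apply: differentiable_comp; [exact: phi_diff|exact/J_diff/phiUW].
have dYPJ := derivable_mulmx dYP dJ.
have covF : cov_along G phi (fun y => F_op G J phi y Y) x X =
    hess x X Y *m J (phi x) -
    ('D_X (fun y => Y *m P_mx y) x *m 'J phi x + hess x X (Y *m P_mx x)).
  have -> : (fun y => F_op G J phi y Y) =
      (fun y => Y *m 'J phi y *m J (phi y) - Y *m P_mx y *m 'J phi y).
    by apply/funext => y; rewrite -P_opE.
  rewrite (cov_alongB Ux dJYJ dYPJ) (cov_along_cplx Ux dJY).
  exact: (congr1 (fun v => _ - v) (cov_along_tangent Ux dYP)).
have := congr1 (fun v => inner G (phi x) v xi) nF0.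
rewrite /nablaF /normal_cov covF innerBl !inner_normal_part // /J_op.
rewrite [inner G _ 0 xi]/inner !mul0mx mxE innerBl innerDl inner_tangent_normal //.
(* The term [F (nabla_X Y)] removes the tangential part of [hess x X Y] under [J], leaving [J]
   applied to the second fundamental form. *)
rewrite add0r addrAC /second_fundamental_form mulmxBl innerBl.
by move=> /eqP; rewrite subr_eq0 => /eqP.
Qed.

Lemma P_mx_weingarten x xi : U x -> is_normal G phi x xi ->
  (forall X Y, nablaF G J phi (fun=> Y) x X = 0) ->
  P_mx x *m weingarten G phi x xi = - (weingarten G phi x xi *m P_mx x).
Proof.
move=> Ux xin nF0; rewrite /weingarten.
set S := \matrix_(i, j) _; set g := pullback_metric G phi x.
pose s X Y := inner G (phi x) (hess x X Y) xi.
have sC X Y : s X Y = s Y X by rewrite /s cov_along_jacobianC.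
have slin X : scalar (s X).
  move=> a Y1 Y2; rewrite /s (cov_along_jacobian_linear X Ux) innerDl.
  by rewrite innerZl.
have SE i j : S i j = s (delta_mx 0 i) (delta_mx 0 j) by rewrite mxE inner_sff.
have sP X Y : s X (Y *m P_mx x) = s Y (X *m P_mx x).
  apply: etrans (inner_sff_P Ux xin (nF0 X Y)) _.
  by rewrite (sffC X Y Ux) -(inner_sff_P Ux xin (nF0 Y X)).
(* Matrix form of [sP]: both entries are expansions of [s] in the standard basis. *)
have PS : P_mx x *m S = S *m (P_mx x)^T.
  apply/matrixP => i j; rewrite !mxE.
  transitivity (s (delta_mx 0 j) (delta_mx 0 i *m P_mx x)).
    rewrite (scalar_sum_delta _ (slin _)); apply: eq_bigr => l _.
    by rewrite -rowE [row _ _ _ _]mxE SE sC.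
  rewrite sP (scalar_sum_delta _ (slin _)); apply: eq_bigr => l _.
  by rewrite -rowE [row _ _ _ _]mxE [_^T _ _]mxE SE mulrC.
have ug : g \in unitmx by exact: pullback_metric_unit.
(* Skewness of P, rewritten so that [(P_mx x)^T] can be moved past the inverse metric in the
   Weingarten matrix. *)
have Pg : (P_mx x)^T *m invmx g = - (invmx g *m P_mx x).
  rewrite -[LHS](mulKmx ug) (mulmxA g).
  have -> : g *m (P_mx x)^T = - (P_mx x *m g) by rewrite P_mx_skew // opprK.
  by rewrite mulNmx mulmxK // mulmxN.
by rewrite mulmxA PS -mulmxA Pg mulmxN mulmxA.
Qed.

(** A nonzero vector killed by P would have slant angle [acos 0], that is [pi / 2]. *)
Lemma P_mx_unit x theta : U x -> theta <> pi / 2 ->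
  (forall X, X != 0 -> slant_angle G J phi x X = theta) -> P_mx x \in unitmx.
Proof.
move=> Ux theta_neq slantx; rewrite -row_free_unit -kermx_eq0.
apply/rowV0P => X /sub_kermxP XP; apply/eqP; apply: contraT => /slantx.
rewrite /slant_angle P_opE XP mul0mx {1}/Defs.gnorm /inner !mul0mx mxE sqrtr0 mul0r.
by rewrite acos0 => /esym/theta_neq.
Qed.

Lemma mup_char_poly_weingarten x xi theta lam : U x -> is_normal G phi x xi ->
  theta <> pi / 2 ->
  (forall X, X != 0 -> slant_angle G J phi x X = theta) ->
  (forall X Y, nablaF G J phi (fun=> Y) x X = 0) ->
  mup lam (char_poly (weingarten G phi x xi)) =
  mup (- lam) (char_poly (weingarten G phi x xi)).
Proof.
move=> Ux xin theta_neq slantx nF0.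
by apply: (mup_char_poly_anticomm _ (P_mx_unit Ux theta_neq slantx)); apply: P_mx_weingarten.
Qed.

End LocalGeometry.

(** * From the local statement to manifolds *)

Lemma open_local_dom (R : realType) (n k : nat) (N : manifold R n)
    (M : manifold R k) (f : N -> M) (a : chart R N n) (b : chart R M k) :
  continuous f -> open (local_dom f a b).
Proof.
move=> fc; have ao : open (cimg a) := @cimg_open _ _ _ a.
(* As the image of the chart is open, continuity within it is continuity at each of its points. *)
have ac : {in cimg a, continuous (cinv a)}.
  by rewrite -continuous_open_subspace //; apply: cinv_continuous.
rewrite openE => x [ax bx].
have nx : nbhs x (cimg a) by exact: open_nbhs_nbhs.
have cx : {for x, continuous (f \o cinv a)}.
  by apply: continuous_comp; [apply: ac; rewrite ?inE|apply: fc].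
by apply: filterI => //; apply: cx; apply: open_nbhs_nbhs; split; [exact: cdom_open|].
Qed.

(** For a constant field the covariant derivative reduces to its Christoffel term; this supplies the
    hypothesis [J_parallel] of the local part. *)
Lemma cplx_parallel_pointwise (R : realType) (k : nat) (M : kaehler_manifold R k)
    (c : chart R M k) (p u v : 'rV[R]_k) :
  atlas c -> cimg c p ->
  v *m 'D_u (cplx c) p + christoffel (metric c) p u (v *m cplx c p) =
  christoffel (metric c) p u v *m cplx c p.
Proof.
move=> ac cp; have := cplx_parallel u ac (@smooth_on_cst _ _ _ _ v) cp.
rewrite /cov derive_cst add0r => <-; congr (_ + _).
have /(@diff_derivable _ _ _ _ _ u)/derivableP dJ : differentiable (cplx c) p.
  exact: (cplx_smooth ac [::]).
by have [_ ->] := is_derive_mulmxr v dJ.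
Qed.

Theorem theorem3p8 (R : realType) (n k : nat)
  (N : manifold R n) (M : kaehler_manifold R k) (f : N -> M) :
  immersion f -> proper_slant f -> F_parallel f -> austere f.
Proof.
move=> [fc fimm] [theta [slantf _ theta_neq]] Fpar a b x xi aa ab Ux xin lam.
have [phi_smooth phi_imm] := fimm a b aa ab.
(* The slant angle, [nablaF] and the Weingarten map are all computed in one pair of charts, so the
   local result applies to the local representative of [f]. *)
apply: (mup_char_poly_weingarten (J := cplx b) (U := local_dom f a b)
  (W := cimg b) _ _ _ _ _ _ _ _ _ _ _ _ lam Ux xin theta_neq) => //.
- exact: open_local_dom.
- exact: cimg_open.
- by move=> y [_ ?]; exists (f (cinv a y)).
- exact: metric_smooth.
- by move=> p bp; apply: Defs.metric_sym.
- by move=> p u bp; apply: metric_pos.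
- exact: cplx_smooth.
- by move=> p bp; apply: cplx_sqr.
- by move=> p u v bp; apply: cplx_isometry.
- by move=> p u v bp; apply: cplx_parallel_pointwise.
- by move=> X; apply: slantf.
- by move=> X Y; apply: Fpar => //; apply: smooth_on_cst.
Qed.
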